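(* Let $(\mathbb{K},\nu)$ be a valued field with $\nu:\mathbb{K}\to\Gamma\cup\{-\infty\}$, let $\underline\gamma=(\gamma_1,\ldots,\gamma_n)\in\Gamma^n$, and let $\nu_{\underline\gamma}$ be the associated monomial valuation on $\mathbb{K}[x_1,\ldots,x_n]$. Then the graded ring $\mathrm{gr}_{\nu_{\underline\gamma}}(\mathbb{K}[x_1,\ldots,x_n])$ is isomorphic, as a graded ring, to $\mathrm{gr}_\nu(\mathbb{K})[X_1,\ldots,X_n]$ with $X_i$ of weight $\gamma_i$. Namely, $$\mathrm{gr}_{\nu_{\underline\gamma}}(\mathbb{K}[x_1,\ldots,x_n])=\mathrm{gr}_\nu(\mathbb{K})[\mathrm{in}_{\nu_{\underline\gamma}}(x_1),\ldots,\mathrm{in}_{\nu_{\underline\gamma}}(x_n)],$$ where $\mathrm{in}_{\nu_{\underline\gamma}}(x_1),\ldots,\mathrm{in}_{\nu_{\underline\gamma}}(x_n)$ are algebraically independent over $\mathrm{gr}_\nu(\mathbb{K})$. More precisely, for every $f\in\mathbb{K}[x_1,\ldots,x_n]$ the initial form $\mathrm{in}_{\nu_{\underline\gamma}}(f)$ equals $\mathrm{IN}_{\underline\gamma}(f)(\mathrm{in}_{\nu_{\underline\gamma}}(x_1),\ldots,\mathrm{in}_{\nu_{\underline\gamma}}(x_n))$.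
   Context: $\Gamma$ is a totally ordered abelian group. A valuation on a commutative ring $R$ (max-plus convention) is a map $\nu:R\to\Gamma\cup\{-\infty\}$ with $\nu(ab)=\nu(a)+\nu(b)$, $\nu(a+b)\leqslant\max\{\nu(a),\nu(b)\}$, $\nu(1)=0$, and $\nu(a)=-\infty$ iff $a=0$. For $\gamma\in\Gamma$, $\mathcal{I}_\gamma=\{a\in R:\nu(a)\leqslant\gamma\}$, $\mathcal{I}^+_\gamma=\{a\in R:\nu(a)<\gamma\}$; $\mathrm{gr}_\nu(R)=\bigoplus_{\gamma\in\Gamma}\mathcal{I}_\gamma/\mathcal{I}^+_\gamma$ with the induced multiplication; $\mathrm{in}_\nu(a)=a\bmod\mathcal{I}^+_{\nu(a)}$ for $a\ne0$ and $\mathrm{in}_\nu(0)=0$. For nonzero $f=\sum_{u}c_ux^u\in\mathbb{K}[x_1,\ldots,x_n]$ ($u\in\mathbb{N}^n$), the monomial valuation is $\nu_{\underline\gamma}(f)=\max_{c_u\ne0}\big(\nu(c_u)+\sum_{i=1}^nu_i\gamma_i\big)$, and $\nu_{\underline\gamma}(0)=-\infty$. It is a valuation. Put $$\mathrm{IN}_{\underline\gamma}(f)=\sum_{u\in U_0}\mathrm{in}_\nu(c_u)X^u\in\mathrm{gr}_\nu(\mathbb{K})[X_1,\ldots,X_n],\qquad U_0=\{u: c_u\neq0,\ \nu_{\underline\gamma}(c_ux^u)=\nu_{\underline\gamma}(f)\},$$ and $\mathrm{IN}_{\underline\gamma}(0)=0$. The ring $\mathrm{gr}_\nu(\mathbb{K})[X_1,\ldots,X_n]$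 is graded by giving $\theta X^u$, with $\theta\in\mathrm{gr}_\nu(\mathbb{K})$ homogeneous, the degree $\deg(\theta)+\sum_iu_i\gamma_i$. The ring $\mathrm{gr}_{\nu_{\underline\gamma}}(\mathbb{K}[x_1,\ldots,x_n])$ is a $\mathrm{gr}_\nu(\mathbb{K})$-algebra via the injective ring morphism with $\mathrm{in}_\nu(c)\mapsto\mathrm{in}_{\nu_{\underline\gamma}}(c)$, so that $\mathrm{in}_\nu(c)\cdot\mathrm{in}_{\nu_{\underline\gamma}}(f)=\mathrm{in}_{\nu_{\underline\gamma}}(cf)$. *)

(* Defs.v *)
From HB Require Import structures.
From mathcomp Require Import all_boot all_order all_algebra.
From mathcomp Require Import boolp classical_sets fsbigop.
From mathcomp Require Import mpoly.

Set Implicit Arguments.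
Unset Strict Implicit.
Unset Printing Implicit Defensive.

Import Order.TTheory GRing.Theory Num.Theory.
Import Quotient.
Local Open Scope ring_scope.
Local Open Scope quotient_scope.

HB.mixin Record isOrderedAbGroup G of Num.POrderedZmodule G := {
  oag_le_total : forall x y : G, (x <= y) || (y <= x);
  oag_leD2l : forall x y z : G, y <= z -> x + y <= x + z
}.

#[short(type="orderedAbGroupType")]
HB.structure Definition OrderedAbGroup :=
  { G of Num.POrderedZmodule G & isOrderedAbGroup G }.

Section OrderedAbGroupTheory.
Variable G : orderedAbGroupType.
Implicit Types x y z t : G.

Lemma oag_comparable x y : x >=< y.
Proof. exact: oag_le_total. Qed.

Lemma oag_ltNge x y : (x < y) = ~~ (y <= x).
Proof. exact: comparable_ltNge (oag_comparable x y). Qed.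

Lemma oag_leD2lE x y z : (x + y <= x + z) = (y <= z).
Proof.
apply/idP/idP => [h|]; last exact: oag_leD2l.
by have := oag_leD2l (- x) _ _ h; rewrite !addKr.
Qed.

Lemma oag_leD2rE x y z : (y + x <= z + x) = (y <= z).
Proof. by rewrite ![_ + x]addrC oag_leD2lE. Qed.

Lemma oag_ltD2lE x y z : (x + y < x + z) = (y < z).
Proof. by rewrite !oag_ltNge oag_leD2lE. Qed.

Lemma oag_ltD2rE x y z : (y + x < z + x) = (y < z).
Proof. by rewrite !oag_ltNge oag_leD2rE. Qed.

Lemma oag_leD x y z t : x <= y -> z <= t -> x + z <= y + t.
Proof.
by move=> h1 h2; apply: (le_trans (y := y + z));
  rewrite ?oag_leD2rE ?oag_leD2lE.
Qed.

End OrderedAbGroupTheory.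

(* [ext G] is G \cup {-oo}, with [None] for -oo. *)
Definition ext (G : Type) : Type := option G.
Definition fin (G : Type) (g : G) : ext G := Some g.
Definition NInf {G : Type} : ext G := None.

HB.instance Definition _ (G : choiceType) := Choice.copy (ext G) (option G).

Section ExtOrder.
Variable G : orderedAbGroupType.
Implicit Types x y z : ext G.

Definition ext_le x y : bool :=
  match x, y with
  | None, _ => true
  | Some _, None => false
  | Some a, Some b => a <= b
  end.

Lemma ext_le_refl : reflexive ext_le.
Proof. by case=> [a|] /=. Qed.

Lemma ext_le_anti : antisymmetric ext_le.
Proof. by case=> [a|] [b|] //= /le_anti ->. Qed.

Lemma ext_le_trans : transitive ext_le.
Proof. by case=> [a|] [b|] [c|] //=; apply: le_trans. Qed.

Lemma ext_le_total : total ext_le.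
Proof. by case=> [a|] [b|] //=; apply: oag_le_total. Qed.

HB.instance Definition _ := Order.Le_isPOrder.Build ring_display (ext G)
  ext_le_refl ext_le_anti ext_le_trans.
HB.instance Definition _ := Order.POrder_isTotal.Build ring_display (ext G)
  ext_le_total.

Definition ext_add x y : ext G :=
  match x, y with
  | Some a, Some b => Some (a + b)
  | _, _ => None
  end.

End ExtOrder.

Reserved Notation "x +^ y" (at level 50, left associativity).
Notation "x +^ y" := (ext_add x y) : ring_scope.

Section ExtTheory.
Variable G : orderedAbGroupType.
Implicit Types (x y z t : ext G) (a b : G).

Lemma fin_inj : injective (@fin G). Proof. by move=> a b []. Qed.

Lemma ext_le_fin a b : (fin a <= fin b) = (a <= b). Proof. by []. Qed.

Lemma ext_lt_fin a b : (fin a < fin b) = (a < b).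
Proof. by rewrite ltNge oag_ltNge ext_le_fin. Qed.

Lemma ext_leN x : NInf <= x. Proof. by []. Qed.

Lemma ext_leNE x : (x <= NInf) = (x == NInf). Proof. by case: x. Qed.

Lemma ext_ltN a : NInf < fin a. Proof. by rewrite ltNge. Qed.

Lemma ext_addC x y : x +^ y = y +^ x.
Proof. by case: x y => [a|] [b|] //=; rewrite addrC. Qed.

Lemma ext_addA x y z : x +^ (y +^ z) = x +^ y +^ z.
Proof. by case: x y z => [a|] [b|] [c|] //=; rewrite addrA. Qed.

Lemma ext_addN x : x +^ NInf = NInf. Proof. by case: x. Qed.

Lemma ext_add0 x : x +^ fin 0 = x. Proof. by case: x => //= a; rewrite addr0. Qed.

Lemma ext_leD x y z t : x <= y -> z <= t -> x +^ z <= y +^ t.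
Proof.
case: x y z t => [a|] [b|] [c|] [d|] //= h1 h2; exact: oag_leD.
Qed.

Lemma ext_leDfin a x y : (x +^ fin a <= y +^ fin a) = (x <= y).
Proof.
case: x y => [b|] [c|] //=.
by change ((b + a <= c + a) = (b <= c)); rewrite oag_leD2rE.
Qed.

Lemma ext_ltDfin a x y : (x +^ fin a < y +^ fin a) = (x < y).
Proof. by rewrite !ltNge ext_leDfin. Qed.

End ExtTheory.

Record valuation (G : orderedAbGroupType) (R : comNzRingType) := Valuation {
  val_fun :> R -> ext G;
  valuationM : forall a b, val_fun (a * b) = val_fun a +^ val_fun b;
  valuationD : forall a b,
    val_fun (a + b) <= Num.max (val_fun a) (val_fun b);
  valuation1 : val_fun 1 = fin 0;
  valuation_eqN : forall a, val_fun a = NInf <-> a = 0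
}.

Section ValuationTheory.
Variables (G : orderedAbGroupType) (R : comNzRingType) (nu : valuation G R).

Lemma valuation0 : nu 0 = NInf. Proof. exact/valuation_eqN. Qed.

Lemma valuationN1 : nu (- 1) = fin 0.
Proof.
have : nu (- 1) +^ nu (- 1) = fin 0 by rewrite -valuationM mulrNN mulr1 valuation1.
case E: (nu (- 1)) => [g|] //= /fin_inj gg; congr Some.
have [h|h|//] := comparable_ltgtP (oag_comparable g 0).
  by have := h; rewrite -(oag_ltD2lE g) gg addr0 => /(lt_trans h); rewrite ltxx.
by have := h; rewrite -(oag_ltD2lE g) gg addr0 => /lt_trans/(_ h); rewrite ltxx.
Qed.

Lemma valuationN a : nu (- a) = nu a.
Proof. by rewrite -mulN1r valuationM valuationN1 ext_addC ext_add0. Qed.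

Lemma valuation_le_sub x a b : nu a <= x -> nu b <= x -> nu (a - b) <= x.
Proof.
by move=> ha hb; apply: le_trans (valuationD _ _ _) _; rewrite ge_max ha valuationN.
Qed.

Lemma valuation_lt_sub x a b : nu a < x -> nu b < x -> nu (a - b) < x.
Proof.
by move=> ha hb; apply: le_lt_trans (valuationD _ _ _) _; rewrite gt_max ha valuationN.
Qed.

(* I_g, as a subgroup of R and as an additive group in its own right *)
Definition vfilt g : {pred R} := fun a => nu a <= fin g.

Lemma vfilt_zmod_closed g : zmod_closed (vfilt g).
Proof.
by split=> [|a b]; rewrite /in_mem /= /vfilt ?valuation0 //; apply: valuation_le_sub.
Qed.

HB.instance Definition _ g :=
  GRing.isZmodClosed.Build R (vfilt g) (vfilt_zmod_closed g).

Record vfilt_type g := VFilt { vfilt_val :> R; vfiltP : vfilt_val \in vfilt g }.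

HB.instance Definition _ g := [isSub for @vfilt_val g].
HB.instance Definition _ g := [Choice of vfilt_type g by <:].
HB.instance Definition _ g := [SubChoice_isSubZmodule of vfilt_type g by <:].

(* I_g^+, as a subgroup of I_g *)
Definition vfilt_lt g : {pred vfilt_type g} :=
  fun a : vfilt_type g => nu (vfilt_val a) < fin g.
Arguments vfilt_lt : clear implicits.

Lemma vfilt_lt_zmod_closed g : zmod_closed (vfilt_lt g).
Proof.
split=> [|a b]; rewrite /in_mem /= /vfilt_lt ?valuation0 //.
exact: valuation_lt_sub.
Qed.

HB.instance Definition _ g :=
  GRing.isZmodClosed.Build (vfilt_type g) (vfilt_lt g) (vfilt_lt_zmod_closed g).

Definition gr_piece g : zmodType := {quot (vfilt_lt g)}.

(* The class of a in I_g / I_g^+; the junk value 0 is used if a is not in I_g. *)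
Definition gr_class g a : gr_piece g :=
  \pi_(gr_piece g) (insubd (0 : vfilt_type g) a).

Definition gr_rep g (x : gr_piece g) : R := vfilt_val (repr x).

Lemma gr_rep_le g (x : gr_piece g) : nu (gr_rep x) <= fin g.
Proof. exact: vfiltP (repr x). Qed.

Lemma gr_repK g (x : gr_piece g) : gr_class g (gr_rep x) = x.
Proof. by rewrite /gr_class /gr_rep (valKd (0 : vfilt_type g) (repr x)) reprK. Qed.

Lemma gr_class_pi g a (h : a \in vfilt g) :
  gr_class g a = \pi_(gr_piece g) (VFilt h).
Proof.
by rewrite /gr_class; congr (\pi); apply: val_inj; rewrite insubdK.
Qed.

Lemma gr_class_eq0 g a : nu a <= fin g -> (gr_class g a == 0) = (nu a < fin g).
Proof.
move=> h; rewrite (gr_class_pi (h : a \in vfilt g)).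
have -> : (0 : gr_piece g) = \pi_(gr_piece g) 0 by rewrite -[LHS]pi_zeror.
by rewrite -[LHS]idealrBE subr0.
Qed.

Lemma gr_class0 g : gr_class g 0 = 0.
Proof.
by apply/eqP; rewrite gr_class_eq0 valuation0 ?ext_leN ?ext_ltN.
Qed.

Lemma gr_classD g a b : nu a <= fin g -> nu b <= fin g ->
  gr_class g (a + b) = gr_class g a + gr_class g b.
Proof.
move=> ha hb.
have hab : nu (a + b) <= fin g.
  by apply: le_trans (valuationD _ _ _) _; rewrite ge_max ha.
rewrite (gr_class_pi (ha : a \in vfilt g)) (gr_class_pi (hb : b \in vfilt g)).
rewrite (gr_class_pi (hab : a + b \in vfilt g)) -[RHS]pi_addr.
by congr (\pi); apply: val_inj.
Qed.

Lemma gr_classN g a : nu a <= fin g -> gr_class g (- a) = - gr_class g a.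
Proof.
move=> ha; apply/eqP; rewrite -addr_eq0 -gr_classD ?valuationN //.
by rewrite addNr gr_class0.
Qed.

Lemma gr_class_eq g a b : nu a <= fin g -> nu b <= fin g ->
  (gr_class g a == gr_class g b) = (nu (a - b) < fin g).
Proof.
move=> ha hb; rewrite -subr_eq0 -gr_classN // -gr_classD ?valuationN //.
by rewrite gr_class_eq0 // valuation_le_sub.
Qed.

(* gr_nu(R), the direct sum of the I_g / I_g^+: finitely supported families *)
Record gr := Gr {
  gr_fun :> forall g, gr_piece g;
  gr_finite : exists s : seq G, forall g, g \notin s -> gr_fun g = 0
}.

Lemma grP (x y : gr) : (forall g, x g = y g) <-> x = y.
Proof.
split=> [|-> //]; case: x y => [x hx] [y hy] /= h.
have e : x = y by apply: functional_extensionality_dep.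
by case: y / e hy {h} => hy; congr Gr; apply: Prop_irrelevance.
Qed.

HB.instance Definition _ := gen_eqMixin gr.
HB.instance Definition _ := gen_choiceMixin gr.

Lemma gr_supp (x : gr) :
  {s : seq G | uniq s & forall g, g \notin s -> x g = 0}.
Proof.
have [s hs] := cid (gr_finite x).
by exists (undup s) => [|g]; rewrite ?undup_uniq // mem_undup; apply: hs.
Qed.

Definition gr_zero : gr.
Proof. by exists (fun g => 0); exists [::]. Defined.

Definition gr_opp (x : gr) : gr.
Proof.
exists (fun g => - x g); case: (gr_finite x) => s hs.
by exists s => g /hs ->; rewrite oppr0.
Defined.

Definition gr_add (x y : gr) : gr.
Proof.
exists (fun g => x g + y g).
case: (gr_finite x) (gr_finite y) => s hs [t ht]; exists (s ++ t) => g.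
by rewrite mem_cat negb_or => /andP[/hs -> /ht ->]; rewrite addr0.
Defined.

Lemma gr_addA : associative gr_add.
Proof. by move=> x y z; apply/grP => g /=; rewrite addrA. Qed.
Lemma gr_addC : commutative gr_add.
Proof. by move=> x y; apply/grP => g /=; rewrite addrC. Qed.
Lemma gr_add0 : left_id gr_zero gr_add.
Proof. by move=> x; apply/grP => g /=; rewrite add0r. Qed.
Lemma gr_addN : left_inverse gr_zero gr_opp gr_add.
Proof. by move=> x; apply/grP => g /=; rewrite addNr. Qed.

HB.instance Definition _ :=
  GRing.isZmodule.Build gr gr_addA gr_addC gr_add0 gr_addN.

Lemma grD (x y : gr) g : (x + y) g = x g + y g. Proof. by []. Qed.
Lemma grN (x : gr) g : (- x) g = - x g. Proof. by []. Qed.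
Lemma gr0 g : (0 : gr) g = 0. Proof. by []. Qed.
Lemma gr_sum I (s : seq I) (P : pred I) (F : I -> gr) g :
  (\sum_(i <- s | P i) F i) g = \sum_(i <- s | P i) F i g.
Proof. by apply: (big_morph (fun x : gr => x g)). Qed.

(* The multiplication I_g / I_g^+ x I_h / I_h^+ -> I_k / I_k^+ induced by that
   of R. It is only used for g + h = k; keeping k free avoids casts. *)
Definition gr_piece_mul g h k (x : gr_piece g) (y : gr_piece h) : gr_piece k :=
  gr_class k (gr_rep x * gr_rep y).

Lemma valuationM_le a b g h : nu a <= fin g -> nu b <= fin h ->
  nu (a * b) <= fin (g + h).
Proof. by rewrite valuationM => ha hb; apply: ext_leD ha hb. Qed.

Lemma valuationM_ltl a b g h : nu a < fin g -> nu b <= fin h ->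
  nu (a * b) < fin (g + h).
Proof.
rewrite valuationM => ha hb; apply: le_lt_trans (ext_leD (lexx _) hb) _.
by rewrite -[fin (g + h)]/(fin g +^ fin h) ext_ltDfin.
Qed.

Lemma gr_class_mul a b g h c d : nu a <= fin g -> nu b <= fin h ->
  nu c <= fin g -> nu d <= fin h ->
  gr_class g a = gr_class g c -> gr_class h b = gr_class h d ->
  gr_class (g + h) (a * b) = gr_class (g + h) (c * d).
Proof.
move=> ha hb hc hd /eqP; rewrite gr_class_eq // => e1 /eqP.
rewrite gr_class_eq // => e2; apply/eqP.
rewrite gr_class_eq ?valuationM_le //.
have -> : a * b - c * d = (a - c) * b - (d - b) * c.
  by rewrite !mulrBl opprB [d * c]mulrC [b * c]mulrC subrKA.
apply: valuation_lt_sub; first exact: valuationM_ltl.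
by rewrite [g + h]addrC; apply: valuationM_ltl => //; rewrite -valuationN opprB.
Qed.

Lemma gr_piece_mulE g h k (a b : R) : g + h = k -> nu a <= fin g -> nu b <= fin h ->
  gr_piece_mul k (gr_class g a) (gr_class h b) = gr_class k (a * b).
Proof.
by move=> <- ha hb; apply: gr_class_mul; rewrite ?gr_rep_le ?gr_repK.
Qed.

Lemma gr_piece_mulDl g h k (x y : gr_piece g) (z : gr_piece h) : g + h = k ->
  gr_piece_mul k (x + y) z = gr_piece_mul k x z + gr_piece_mul k y z.
Proof.
move=> ghk; rewrite -[x]gr_repK -[y]gr_repK -[z]gr_repK.
have l1 := gr_rep_le x; have l2 := gr_rep_le y; have l3 := gr_rep_le z.
rewrite -gr_classD // !gr_piece_mulE //; last first.
  by apply: le_trans (valuationD _ _ _) _; rewrite ge_max l1.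
by rewrite mulrDl gr_classD // -ghk valuationM_le.
Qed.

Lemma gr_piece_mulC g h k (x : gr_piece g) (y : gr_piece h) :
  gr_piece_mul k x y = gr_piece_mul k y x.
Proof. by rewrite /gr_piece_mul mulrC. Qed.

Lemma gr_piece_mulDr g h k (x y : gr_piece h) (z : gr_piece g) : g + h = k ->
  gr_piece_mul k z (x + y) = gr_piece_mul k z x + gr_piece_mul k z y.
Proof.
rewrite addrC => hgk; rewrite gr_piece_mulC gr_piece_mulDl //.
by congr (_ + _); apply: gr_piece_mulC.
Qed.

Lemma gr_piece_mul0 g h k (z : gr_piece h) : g + h = k ->
  gr_piece_mul k (0 : gr_piece g) z = 0.
Proof.
move=> ghk; have := gr_piece_mulDl (0 : gr_piece g) 0 z ghk.
by rewrite addr0 -[LHS]addr0 => /addrI.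
Qed.

Lemma gr_piece_mulr0 g h k (z : gr_piece g) : g + h = k ->
  gr_piece_mul k z (0 : gr_piece h) = 0.
Proof. by move=> ghk; rewrite gr_piece_mulC gr_piece_mul0 // addrC. Qed.

Definition gr_mul_fun (x y : gr) g : gr_piece g :=
  \sum_(h \in [set: G]) gr_piece_mul g (x h) (y (g - h)).

Lemma subKl (a g : G) : a + (g - a) = g. Proof. by rewrite addrC subrK. Qed.

Lemma gr_mul_funE s (x y : gr) g : uniq s -> (forall a, a \notin s -> x a = 0) ->
  gr_mul_fun x y g = \sum_(a <- s) gr_piece_mul g (x a) (y (g - a)).
Proof.
move=> us hs; rewrite /gr_mul_fun (fsbigE s) //.
  by apply: eq_bigl => a; rewrite in_setT.
by move=> a _ /hs ->; rewrite gr_piece_mul0 // subKl.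
Qed.

Lemma gr_mul_finite (x y : gr) :
  exists s : seq G, forall g, g \notin s -> gr_mul_fun x y g = 0.
Proof.
have [s us hs] := gr_supp x; have [t ut ht] := gr_supp y.
exists [seq a + b | a <- s, b <- t] => g hg.
rewrite (gr_mul_funE y g us hs) big_seq big1 // => a sa.
rewrite ht ?gr_piece_mulr0 ?subKl //.
apply: contra hg => tb; apply/allpairsP; exists (a, g - a).
by rewrite /= subKl.
Qed.

Definition gr_mul (x y : gr) : gr := Gr (gr_mul_finite x y).

(* a mod I_g^+, placed in degree g *)
Definition gr_in_deg_fun g a : forall d, gr_piece d :=
  fun d => if d == g then gr_class d a else 0.

Lemma gr_in_deg_finite g a :
  exists s : seq G, forall d, d \notin s -> gr_in_deg_fun g a d = 0.
Proof.
by exists [:: g] => d; rewrite inE /gr_in_deg_fun => /negbTE ->.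
Qed.

Definition gr_in_deg g a : gr := Gr (gr_in_deg_finite g a).

Lemma gr_in_degE g a d : gr_in_deg g a d = if d == g then gr_class d a else 0.
Proof. by []. Qed.

Lemma gr_decomp (x : gr) s : uniq s -> (forall a, a \notin s -> x a = 0) ->
  x = \sum_(g <- s) gr_in_deg g (gr_rep (x g)).
Proof.
move=> us hs; apply/grP => d; rewrite gr_sum.
have [ds|ds] := boolP (d \in s).
  rewrite (bigD1_seq d ds us) gr_in_degE eqxx gr_repK big1 => [|i].
    by rewrite [RHS]addr0.
  by rewrite gr_in_degE eq_sym => /negbTE ->.
rewrite hs // big_seq big1 // => i is_; rewrite gr_in_degE.
by case: eqP is_ ds => // -> ->.
Qed.

Lemma gr_ind (P : gr -> Prop) : P 0 -> (forall x y, P x -> P y -> P (x + y)) ->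
  (forall g a, nu a <= fin g -> P (gr_in_deg g a)) -> forall x, P x.
Proof.
move=> P0 PD Pg x; have [s us hs] := gr_supp x.
rewrite (gr_decomp us hs); elim/big_ind: _ => // g _.
exact: Pg (gr_rep_le _).
Qed.

Lemma gr_in_degM g h a b : nu a <= fin g -> nu b <= fin h ->
  gr_mul (gr_in_deg g a) (gr_in_deg h b) = gr_in_deg (g + h) (a * b).
Proof.
move=> ha hb; apply/grP => d; rewrite /=.
rewrite (@gr_mul_funE [:: g]) //; last first.
  by move=> c; rewrite inE => /negbTE cg; rewrite gr_in_degE cg.
rewrite big_seq1 gr_in_degE eqxx gr_in_degE /gr_in_deg_fun.
rewrite (_ : (d - g == h) = (d == g + h)); last by rewrite subr_eq addrC.
case: eqP => [->|_]; last by rewrite gr_piece_mulr0 // subKl.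
by rewrite [_ - g]addrC addKr gr_piece_mulE.
Qed.

Lemma gr_mulDl : left_distributive gr_mul +%R.
Proof.
move=> x y z; apply/grP => g; rewrite grD /=.
have [s us hs] := gr_supp x; have [t ut ht] := gr_supp y.
pose r := undup (s ++ t); have ur : uniq r := undup_uniq _.
have hx a : a \notin r -> x a = 0.
  by rewrite mem_undup mem_cat negb_or => /andP[/hs].
have hy a : a \notin r -> y a = 0.
  by rewrite mem_undup mem_cat negb_or => /andP[_ /ht].
rewrite !(@gr_mul_funE r) // -?big_split; last first.
  by move=> a ar; rewrite grD hx ?hy ?addr0.
by apply: eq_bigr => a _; rewrite grD gr_piece_mulDl ?subKl.
Qed.

Lemma gr_mulDr : right_distributive gr_mul +%R.
Proof.
move=> z x y; apply/grP => g; rewrite grD /=.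
have [s us hs] := gr_supp z.
rewrite !(gr_mul_funE _ _ us hs) // -big_split.
by apply: eq_bigr => a _; rewrite grD gr_piece_mulDr ?subKl.
Qed.

Lemma gr_mul0l x : gr_mul 0 x = 0.
Proof. by have := gr_mulDl 0 0 x; rewrite addr0 -[LHS]addr0 => /addrI. Qed.

Lemma gr_mul0r x : gr_mul x 0 = 0.
Proof. by have := gr_mulDr x 0 0; rewrite addr0 -[LHS]addr0 => /addrI. Qed.

Definition gr_one : gr := gr_in_deg 0 1.

Lemma gr_mulC : commutative gr_mul.
Proof.
move=> x y; elim/gr_ind: x => [|x x' hx hx'|g a ha].
- by rewrite gr_mul0l gr_mul0r.
- by rewrite gr_mulDl gr_mulDr hx hx'.
elim/gr_ind: y => [|y y' hy hy'|h b hb].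
- by rewrite gr_mul0l gr_mul0r.
- by rewrite gr_mulDl gr_mulDr hy hy'.
by rewrite !gr_in_degM // addrC mulrC.
Qed.

Lemma gr_mulA : associative gr_mul.
Proof.
move=> x y z; elim/gr_ind: x => [|x x' hx hx'|g a ha].
- by rewrite !gr_mul0l.
- by rewrite !gr_mulDl hx hx'.
elim/gr_ind: y => [|y y' hy hy'|h b hb].
- by rewrite !(gr_mul0l, gr_mul0r).
- by rewrite !(gr_mulDl, gr_mulDr) hy hy'.
elim/gr_ind: z => [|z z' hz hz'|k c hc].
- by rewrite !(gr_mul0l, gr_mul0r).
- by rewrite !(gr_mulDl, gr_mulDr) hz hz'.
by rewrite !gr_in_degM ?valuationM_le // addrA mulrA.
Qed.

Lemma gr_mul1 : left_id gr_one gr_mul.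
Proof.
move=> x; elim/gr_ind: x => [|x x' hx hx'|g a ha].
- by rewrite gr_mul0r.
- by rewrite gr_mulDr hx hx'.
by rewrite gr_in_degM ?valuation1 // add0r mul1r.
Qed.

Lemma gr_one_neq0 : gr_one != 0.
Proof.
apply/eqP => /grP /(_ 0); rewrite gr_in_degE eqxx gr0 => /eqP.
by rewrite gr_class_eq0 valuation1 ?ltxx.
Qed.

HB.instance Definition _ := GRing.Zmodule_isComNzRing.Build gr
  gr_mulA gr_mulC gr_mul1 gr_mulDl gr_one_neq0.

Lemma gr_in_deg_mul g h a b : nu a <= fin g -> nu b <= fin h ->
  gr_in_deg g a * gr_in_deg h b = gr_in_deg (g + h) (a * b).
Proof. exact: gr_in_degM. Qed.

Definition initial a : gr :=
  if nu a is Some g then gr_in_deg g a else 0.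

Lemma initial0 : initial 0 = 0.
Proof. by rewrite /initial valuation0. Qed.

Lemma initialE g a : nu a = fin g -> initial a = gr_in_deg g a.
Proof. by rewrite /initial => ->. Qed.

(* the elements of the degree g component of gr_nu(R) *)
Definition gr_homog g (x : gr) : Prop := forall d, d != g -> x d = 0.

Lemma gr_in_deg_homog g a : gr_homog g (gr_in_deg g a).
Proof. by move=> d /negbTE; rewrite gr_in_degE => ->. Qed.

Lemma gr_homogP g (x : gr) :
  gr_homog g x <-> exists2 a, nu a <= fin g & x = gr_in_deg g a.
Proof.
split=> [h|[a _ ->]]; last exact: gr_in_deg_homog.
exists (gr_rep (x g)); first exact: gr_rep_le.
apply/grP => d; rewrite gr_in_degE; case: eqP => [->|/eqP /h ->//].
by rewrite gr_repK.
Qed.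

Lemma gr_homogM g h x y :
  gr_homog g x -> gr_homog h y -> gr_homog (g + h) (x * y).
Proof.
move=> /gr_homogP[a ha ->] /gr_homogP[b hb ->].
by rewrite gr_in_deg_mul //; apply: gr_in_deg_homog.
Qed.

End ValuationTheory.

Section MonomialValuation.
Variables (G : orderedAbGroupType) (K : fieldType) (nu : valuation G K).
Variables (n : nat) (w : 'I_n -> G).
Implicit Types (f h : {mpoly K[n]}) (m : 'X_{1..n}).

Definition mweight m : G := \sum_(i < n) w i *+ m i.

Lemma mweight0 : mweight 0%MM = 0.
Proof. by rewrite /mweight big1 // => i _; rewrite mnm0E mulr0n. Qed.

Lemma mweightD m1 m2 : mweight (m1 + m2)%MM = mweight m1 + mweight m2.
Proof. by rewrite -big_split; apply: eq_bigr => i _; rewrite mnmDE mulrnDr. Qed.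

Lemma mweightU i : mweight U_(i)%MM = w i.
Proof.
rewrite /mweight (bigD1 i) //= mnm1E eqxx mulr1n big1 ?addr0 // => j.
by rewrite mnm1E eq_sym => /negbTE ->.
Qed.

Definition mval_fun f : ext G :=
  \big[Num.max/NInf]_(m <- msupp f) (nu f@_m +^ fin (mweight m)).

Lemma mval_leP f x :
  reflect (forall m, nu f@_m +^ fin (mweight m) <= x) (mval_fun f <= x).
Proof.
apply: (iffP idP) => [h m|h]; last first.
  rewrite /mval_fun big_seq; apply: bigmax_le => [|m _]; first exact: ext_leN.
  exact: h.
apply: le_trans h; have [mf|mf] := boolP (m \in msupp f).
  exact: (@bigmax_sup_seq _ _ _ _ _ m).
by rewrite memN_msupp_eq0 // valuation0 ext_leN.
Qed.

Lemma mval_ltP f g :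
  reflect (forall m, nu f@_m +^ fin (mweight m) < fin g) (mval_fun f < fin g).
Proof.
apply: (iffP idP) => [h m|h].
  by apply: le_lt_trans h; apply/mval_leP: m.
rewrite /mval_fun big_seq; apply: bigmax_lt => [|m _]; first exact: ext_ltN.
exact: h.
Qed.

Lemma mcoeff_le_mval f m : nu f@_m +^ fin (mweight m) <= mval_fun f.
Proof. by apply/mval_leP: m. Qed.

Lemma mval_eqN f : mval_fun f = NInf <-> f = 0.
Proof.
split=> [h|->]; last by rewrite /mval_fun msupp0 big_nil.
apply/mpolyP => m; rewrite mcoeff0; apply/(valuation_eqN nu).
by have := mcoeff_le_mval f m; rewrite h; case: (nu _).
Qed.

Lemma mval_fin f : f != 0 -> {g | mval_fun f = fin g}.
Proof.
move=> f0; case E: (mval_fun f) => [g|]; first by exists g.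
by move/mval_eqN: E f0 => ->; rewrite eqxx.
Qed.

Lemma mvalD f h : mval_fun (f + h) <= Num.max (mval_fun f) (mval_fun h).
Proof.
apply/mval_leP => m; rewrite mcoeffD.
apply: le_trans (ext_leD (valuationD _ _ _) (lexx _)) _.
by rewrite le_max /Order.max; case: ifP => _; rewrite mcoeff_le_mval ?orbT.
Qed.

Lemma mvalC c : mval_fun c%:MP = nu c.
Proof.
rewrite /mval_fun msuppC; case: eqP => [->|_].
  by rewrite big_nil valuation0.
by rewrite big_cons big_nil max_l ?ext_leN // mcoeffC eqxx mulr1 mweight0 ext_add0.
Qed.

Lemma ext_le_subr (x y : ext G) g : (x +^ fin g <= y) = (x <= y +^ fin (- g)).
Proof. by rewrite -(ext_leDfin g x) -ext_addA /= addNr ext_add0. Qed.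

Lemma valuation_le_sum I (r : seq I) (P : pred I) (F : I -> K) x :
  (forall i, P i -> nu (F i) <= x) -> nu (\sum_(i <- r | P i) F i) <= x.
Proof.
move=> h; elim/big_ind: _ => //; first by rewrite valuation0.
by move=> a b ha hb; apply: le_trans (valuationD _ _ _) _; rewrite ge_max ha.
Qed.

Lemma mvalM_le f h : mval_fun (f * h) <= mval_fun f +^ mval_fun h.
Proof.
apply/mval_leP => m; rewrite ext_le_subr mcoeffM.
apply: valuation_le_sum => -[k1 k2] /eqP /= e; rewrite -ext_le_subr valuationM.
have -> : fin (mweight m) = fin (mweight k1) +^ fin (mweight k2).
  by rewrite /= -mweightD -e.
rewrite ext_addA -[_ +^ _ +^ fin (mweight k1)]ext_addA [nu h@__ +^ _]ext_addC.
rewrite ext_addA -ext_addA.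
by apply: ext_leD; apply: mcoeff_le_mval.
Qed.

Lemma mvalM_lt f h a b : mval_fun f < fin a -> mval_fun h <= fin b ->
  mval_fun (f * h) < fin (a + b).
Proof.
move=> ha hb; apply: le_lt_trans (mvalM_le _ _) _.
apply: le_lt_trans (ext_leD (lexx _) hb) _.
by rewrite -[fin (a + b)]/(fin a +^ fin b) ext_ltDfin.
Qed.

Definition mval_max f : pred 'X_{1..n} :=
  fun m => nu f@_m +^ fin (mweight m) == mval_fun f.

Definition mval_top f : {mpoly K[n]} :=
  \sum_(m <- msupp f | mval_max f m) f@_m *: 'X_[m].

Lemma mcoeff_filter (S : nzRingType) (F : 'X_{1..n} -> S) (s : seq 'X_{1..n})
    (P : pred 'X_{1..n}) k : uniq s ->
  (\sum_(m <- s | P m) F m *: 'X_[m])@_k =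
    if (k \in s) && P k then F k else 0.
Proof.
move=> us; rewrite -big_filter raddf_sum /= andbC -mem_filter.
have {us} : uniq [seq m <- s | P m] by rewrite filter_uniq.
move: [seq m <- s | P m] => t ut; case: ifP => [kt|/negbT kt].
  rewrite (bigD1_seq k kt ut) /= mcoeffZ mcoeffX eqxx mulr1 big1 ?addr0 //.
  by move=> i /negbTE ik; rewrite mcoeffZ mcoeffX ik mulr0.
rewrite big_seq big1 // => i it; rewrite mcoeffZ mcoeffX.
by case: eqP it kt => [-> ->|_]; rewrite ?mulr0.
Qed.

Lemma mcoeff_top f m : (mval_top f)@_m = if mval_max f m then f@_m else 0.
Proof.
rewrite mcoeff_filter ?msupp_uniq //.
have [//|/memN_msupp_eq0 ->] := boolP (m \in msupp f).
by case: ifP.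
Qed.

Lemma mval_top_le f : mval_fun (mval_top f) <= mval_fun f.
Proof.
apply/mval_leP => m; rewrite mcoeff_top; case: ifP => _.
  exact: mcoeff_le_mval.
by rewrite valuation0 ext_leN.
Qed.

Lemma mval_rest_lt f g : mval_fun f = fin g ->
  mval_fun (f - mval_top f) < fin g.
Proof.
move=> fg; apply/mval_ltP => m; rewrite mcoeffB mcoeff_top /mval_max fg.
case: eqP => [_|/eqP ne]; first by rewrite subrr valuation0 ext_ltN.
by rewrite subr0 lt_neqAle ne -fg mcoeff_le_mval.
Qed.

Lemma mval_top_neq0 f : f != 0 -> mval_top f != 0.
Proof.
move=> f0; have [g fg] := mval_fin f0; apply/eqP => t0.
by have := mval_rest_lt fg; rewrite t0 subr0 fg ltxx.
Qed.

Lemma mval_top_mlead f : f != 0 ->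
  nu (mval_top f)@_(mlead (mval_top f)) +^ fin (mweight (mlead (mval_top f)))
  = mval_fun f.
Proof.
move=> /mval_top_neq0; rewrite -mleadc_eq0 mcoeff_top.
by case: ifP => [/eqP|]; rewrite ?eqxx.
Qed.

Lemma mvalM f h : mval_fun (f * h) = mval_fun f +^ mval_fun h.
Proof.
have z : mval_fun 0 = NInf by apply/mval_eqN.
have [->|f0] := eqVneq f 0; first by rewrite mul0r z.
have [->|h0] := eqVneq h 0; first by rewrite mulr0 z ext_addN.
apply/le_anti; rewrite mvalM_le /=.
have [a fa] := mval_fin f0; have [b hb] := mval_fin h0.
set f1 := mval_top f; set h1 := mval_top h.
pose r := f1 * (h - h1) + (f - f1) * h.
have rlt : mval_fun r < fin (a + b).
  apply: le_lt_trans (mvalD _ _) _; rewrite gt_max; apply/andP; split.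
    rewrite mulrC [a + b]addrC; apply: mvalM_lt; first exact: mval_rest_lt.
    by rewrite -fa mval_top_le.
  by apply: mvalM_lt; [exact: mval_rest_lt|rewrite hb].
have e : f * h = f1 * h1 + r.
  by rewrite /r mulrBr mulrBl addrA [f1 * h1 + _]addrC subrK addrC subrK.
set k := (mlead f1 + mlead h1)%MM.
have ek : (f * h)@_k = f1@_(mlead f1) * h1@_(mlead h1) + r@_k.
  by rewrite e mcoeffD mleadcM.
have tk : nu (f1@_(mlead f1) * h1@_(mlead h1)) +^ fin (mweight k) = fin (a + b).
  rewrite valuationM mweightD -[fin (mweight _ + _)]/(fin _ +^ fin _).
  rewrite ext_addA -[_ +^ _ +^ fin (mweight (mlead f1))]ext_addA.
  rewrite [nu h1@__ +^ _]ext_addC ext_addA -ext_addA.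
  by rewrite !mval_top_mlead // fa hb.
apply: le_trans (mcoeff_le_mval _ k); rewrite fa hb leNgt; apply/negP => lt.
have := ltxx (fin (a + b)); rewrite -{1}tk.
rewrite (_ : _ * _ = (f * h)@_k - r@_k); last by rewrite ek addrK.
suff -> : nu ((f * h)@_k - r@_k) +^ fin (mweight k) < fin (a + b) by [].
have rk : nu r@_k +^ fin (mweight k) < fin (a + b) by move: k {ek tk lt}; apply/mval_ltP.
have le := valuationD nu (f * h)@_k (- r@_k).
apply: le_lt_trans (ext_leD le (lexx _)) _.
by rewrite valuationN /Order.max; case: ifP.
Qed.

Lemma mval1 : mval_fun 1 = fin 0.
Proof. by rewrite -[1]/(1%:MP) mvalC valuation1. Qed.

Lemma mvalX m : mval_fun 'X_[m] = fin (mweight m).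
Proof.
rewrite /mval_fun msuppX big_cons big_nil max_l ?ext_leN // mcoeffX eqxx.
by rewrite valuation1 /= add0r.
Qed.

Lemma mvalZX c m : mval_fun (c *: 'X_[m]) = nu c +^ fin (mweight m).
Proof. by rewrite -mul_mpolyC mvalM mvalC mvalX. Qed.

Definition monomial_valuation : valuation G {mpoly K[n]} :=
  Valuation mvalM mvalD mval1 mval_eqN.

End MonomialValuation.

Section InitialForm.
Variables (G : orderedAbGroupType) (K : fieldType) (nu : valuation G K).
Variables (n : nat) (w : 'I_n -> G).
Local Notation nuw := (monomial_valuation nu w).

Definition initial_poly (f : {mpoly K[n]}) : {mpoly (gr nu)[n]} :=
  \sum_(m <- msupp f | nuw (f@_m *: 'X_[m]) == nuw f)
    initial nu f@_m *: 'X_[m].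

(* The grading of gr_nu(K)[X_1, ..., X_n] with X_i of weight w i *)
Definition mpoly_homog (g : G) (P : {mpoly (gr nu)[n]}) : Prop :=
  forall m, gr_homog (g - mweight w m) P@_m.

(* The structure map gr_nu(K) -> gr_nuw(K[x_1, ..., x_n]), induced on each piece
   by c |-> c%:MP; see [gr_scalar_initial] and [gr_scalar_inj]. *)
Definition gr_scalar_fun (x : gr nu) g : gr_piece nuw g :=
  gr_class nuw g (gr_rep (x g))%:MP.

Lemma gr_scalar_finite (x : gr nu) :
  exists s : seq G, forall g, g \notin s -> gr_scalar_fun x g = 0.
Proof.
have [s hs] := gr_finite x; exists s => g /hs xg; apply/eqP.
have [h1 h2] : nu (gr_rep (x g)) <= fin g /\ nu (gr_rep (x g)) < fin g.
  by split; [exact: gr_rep_le|rewrite -gr_class_eq0 ?gr_rep_le // gr_repK xg].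
by rewrite /gr_scalar_fun gr_class_eq0 /= mvalC.
Qed.

Definition gr_scalar (x : gr nu) : gr nuw := Gr (gr_scalar_finite x).

Lemma gr_scalar_class g (a : K) : nu a <= fin g ->
  gr_class nuw g (gr_rep (gr_class nu g a))%:MP = gr_class nuw g a%:MP.
Proof.
move=> ha; apply/eqP.
rewrite gr_class_eq /= ?mvalC ?gr_rep_le // -mpolyCB mvalC.
by rewrite -gr_class_eq ?gr_rep_le // gr_repK.
Qed.

Lemma gr_scalar_in_deg g (a : K) : nu a <= fin g ->
  gr_scalar (gr_in_deg nu g a) = gr_in_deg nuw g a%:MP.
Proof.
move=> ha; apply/grP => d.
rewrite /= /gr_scalar_fun gr_in_degE /gr_in_deg_fun; case: eqP => [->|_].
  exact: gr_scalar_class.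
by rewrite -(gr_class0 nu d) gr_scalar_class ?valuation0 ?ext_leN // gr_class0.
Qed.

Lemma gr_scalarD (x y : gr nu) :
  gr_scalar (x + y) = gr_scalar x + gr_scalar y.
Proof.
apply/grP => g; rewrite grD /= /gr_scalar_fun grD.
have hx := gr_rep_le (x g); have hy := gr_rep_le (y g).
rewrite -[x g in LHS]gr_repK -[y g in LHS]gr_repK -gr_classD //.
rewrite gr_scalar_class ?mpolyCD ?gr_classD /= ?mvalC //.
by apply: le_trans (valuationD _ _ _) _; rewrite ge_max hx.
Qed.

Lemma gr_scalar0 : gr_scalar 0 = 0.
Proof. by have := gr_scalarD 0 0; rewrite addr0 -[LHS]addr0 => /addrI. Qed.

Lemma gr_scalar_is_zmod_morphism : zmod_morphism gr_scalar.
Proof.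
move=> x y; apply/eqP; rewrite eq_sym subr_eq -gr_scalarD.
by rewrite subrK.
Qed.

Lemma gr_scalar_is_monoid_morphism : monoid_morphism gr_scalar.
Proof.
split=> [|x y].
  by rewrite [LHS]gr_scalar_in_deg ?valuation1.
elim/gr_ind: x => [|x x' hx hx'|g a ha].
- by rewrite mul0r gr_scalar0 mul0r.
- by rewrite mulrDl !gr_scalarD hx hx' mulrDl.
elim/gr_ind: y => [|y y' hy hy'|h b hb].
- by rewrite mulr0 gr_scalar0 mulr0.
- by rewrite mulrDr !gr_scalarD hy hy' mulrDr.
rewrite gr_in_deg_mul // !gr_scalar_in_deg ?valuationM_le //.
by rewrite gr_in_deg_mul /= ?mvalC // mpolyCM.
Qed.

HB.instance Definition _ := GRing.isZmodMorphism.Build (gr nu) (gr nuw)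
  gr_scalar gr_scalar_is_zmod_morphism.
HB.instance Definition _ := GRing.isMonoidMorphism.Build (gr nu) (gr nuw)
  gr_scalar gr_scalar_is_monoid_morphism.

Lemma gr_scalar_initial (c : K) :
  gr_scalar (initial nu c) = initial nuw c%:MP.
Proof.
rewrite /initial [nuw _]mvalC; case E: (nu c) => [g|]; last exact: gr_scalar0.
by rewrite gr_scalar_in_deg // E.
Qed.

Lemma gr_scalar_inj : injective gr_scalar.
Proof.
apply: raddf_inj => x /grP hx; apply/grP => g; have /eqP := hx g.
rewrite /= /gr_scalar_fun gr_class_eq0 /= mvalC ?gr_rep_le //.
by rewrite -gr_class_eq0 ?gr_rep_le // gr_repK => /eqP.
Qed.

End InitialForm.

Definition graded_isomorphism (I : Type) (A B : nzRingType)
    (degA : I -> A -> Prop) (degB : I -> B -> Prop)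
    (phi : {rmorphism A -> B}) : Prop :=
  bijective phi /\ forall g x, degA g x <-> degB g (phi x).

(* B = A[x_1, ..., x_n] for the A-algebra B with structure map i *)
Definition generated_by (A B : nzRingType) (i : A -> B) (n : nat)
    (x : 'I_n -> B) : Prop :=
  forall b : B, exists P : {mpoly A[n]}, b = mmap i x P.

Definition algebraically_independent (A B : nzRingType) (i : A -> B) (n : nat)
    (x : 'I_n -> B) : Prop :=
  forall P : {mpoly A[n]}, mmap i x P = 0 -> P = 0.

(* Main.v *)
(** The component of degree [g] of [ev P] is the class of the polynomial whose
    coefficient at [x^m] lifts the component of degree [g - mweight w m] of
    [P@_m]. A polynomial has valuation less than [g] if and only if each of its
    terms has, so this component vanishes if and only if all those components of
    the coefficients of [P] do: this gives both injectivity and the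
    compatibility with the gradings. Surjectivity holds because a class of
    degree [g] is the sum of the classes of the terms of a representative; for
    the initial form of [f], the terms of valuation less than that of [f] do not
    contribute. *)
Require Import Defs.
From HB Require Import structures.
From mathcomp Require Import all_boot all_order all_algebra.
From mathcomp Require Import boolp.
From mathcomp Require Import mpoly.

Set Implicit Arguments.
Unset Strict Implicit.
Unset Printing Implicit Defensive.

Import Order.TTheory GRing.Theory.
Local Open Scope ring_scope.

Lemma gr_in_deg_eq (G : orderedAbGroupType) (R : comNzRingType)
    (nu : valuation G R) g a b :
  nu a <= fin g -> nu b <= fin g -> nu (a - b) < fin g ->
  gr_in_deg nu g a = gr_in_deg nu g b.
Proof.
move=> ha hb hab; apply/grP => d; rewrite !gr_in_degE; case: eqP => // ->.
by apply/eqP; rewrite gr_class_eq.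
Qed.

Lemma gr_class_sum (G : orderedAbGroupType) (R : comNzRingType)
    (nu : valuation G R) g I (r : seq I) (P : pred I) (F : I -> R) :
  (forall i, P i -> nu (F i) <= fin g) ->
  gr_class nu g (\sum_(i <- r | P i) F i) =
    \sum_(i <- r | P i) gr_class nu g (F i).
Proof.
(* [gr_class] is additive only on elements of valuation at most [g] (elsewhere it takes a junk
   value), so the induction carries this bound along with the equality. *)
move=> hF; pose K a (x : gr_piece nu g) := nu a <= fin g /\ gr_class nu g a = x.
suff [_ //] : K (\sum_(i <- r | P i) F i) (\sum_(i <- r | P i) gr_class nu g (F i)).
apply: (big_ind2 K) => [|a x b y [ha <-] [hb <-]|i /hF //].
  by split; [rewrite valuation0|exact: gr_class0].
by split; [rewrite (le_trans (valuationD _ _ _)) // ge_max ha|rewrite gr_classD].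
Qed.

Lemma gr_in_deg_sum (G : orderedAbGroupType) (R : comNzRingType)
    (nu : valuation G R) g I (r : seq I) (P : pred I) (F : I -> R) :
  (forall i, P i -> nu (F i) <= fin g) ->
  gr_in_deg nu g (\sum_(i <- r | P i) F i) =
    \sum_(i <- r | P i) gr_in_deg nu g (F i).
Proof.
move=> hF; apply/grP => d; rewrite gr_sum gr_in_degE.
case: eqP => [->|/eqP/negbTE dg].
  by rewrite gr_class_sum //; apply: eq_bigr => i _; rewrite gr_in_degE eqxx.
by rewrite big1 // => i _; rewrite gr_in_degE dg.
Qed.

Section Evaluation.
Variables (G : orderedAbGroupType) (K : fieldType) (nu : valuation G K).
Variables (n : nat) (w : 'I_n -> G).
Local Notation nuw := (monomial_valuation nu w).
(* [mpoly] exports an unrelated notation [mweight]. *)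
Local Notation mweight := Defs.mweight.

Definition gr_var (i : 'I_n) : gr nuw := initial nuw 'X_i.

Definition gr_eval : {mpoly (gr nu)[n]} -> gr nuw := mmap (gr_scalar w) gr_var.

HB.instance Definition _ := GRing.RMorphism.on gr_eval.

Lemma nuw_monomial c (m : 'X_{1..n}) :
  nuw (c *: 'X_[m]) = nu c +^ fin (mweight w m).
Proof. exact: mvalZX. Qed.

Lemma nuw_monomial_le g c (m : 'X_{1..n}) :
  (nuw (c *: 'X_[m]) <= fin g) = (nu c <= fin (g - mweight w m)).
Proof. by rewrite nuw_monomial ext_le_subr. Qed.

(** Both sides turn sums of exponents into products, which reduces the claim to the exponents
    [U_(i)]; there it holds because ['X_i] has valuation [w i]. *)
Lemma mmap1_gr_var m : mmap1 gr_var m = gr_in_deg nuw (mweight w m) 'X_[m].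
Proof.
have mulX m1 m2 : gr_in_deg nuw (mweight w (m1 + m2)) 'X_[m1 + m2] =
    gr_in_deg nuw (mweight w m1) 'X_[m1] * gr_in_deg nuw (mweight w m2) 'X_[m2].
  by rewrite gr_in_deg_mul /= ?mvalX // mpolyXD mweightD.
have X0 : gr_in_deg nuw (mweight w 0%MM) 'X_[0%MM] = 1.
  by rewrite mpolyX0 mweight0.
pose F m := gr_in_deg nuw (mweight w m) 'X_[m].
rewrite -/(F m) {2}[m]multinomUE_id (big_morph F mulX X0).
apply: eq_bigr => i _.
have -> : gr_var i = F U_(i)%MM.
  by rewrite /gr_var (@initialE _ _ nuw _ _ (mvalX nu w _)).
elim: (m i) => [|k IH]; first by rewrite expr0 mulm0n.
by rewrite exprS IH mulmS -mulX.
Qed.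

Lemma gr_evalE P : gr_eval P = \sum_(m <- msupp P)
  gr_scalar w P@_m * gr_in_deg nuw (mweight w m) 'X_[m].
Proof. by apply: eq_bigr => m _; rewrite -mmap1_gr_var. Qed.

(** Stated with [gr_in_deg] rather than [initial] so as to cover [nu c < fin d], where both sides
    vanish. *)
Lemma gr_eval_term d c m : nu c <= fin d ->
  gr_eval (gr_in_deg nu d c *: 'X_[m]) =
    gr_in_deg nuw (d + mweight w m) (c *: 'X_[m]).
Proof.
move=> hc; rewrite /gr_eval mmapZ mmapX mmap1_gr_var /= gr_scalar_in_deg //.
by rewrite gr_in_deg_mul /= ?mvalC ?mvalX // mul_mpolyC.
Qed.

Lemma gr_eval_component P g : gr_eval P g = gr_class nuw g
  (\sum_(m <- msupp P) gr_rep (P@_m (g - mweight w m)) *: 'X_[m]).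
Proof.
rewrite gr_evalE gr_sum gr_class_sum => [|m _]; last first.
  by rewrite nuw_monomial_le gr_rep_le.
(* With the homogeneous factor on the left, the convolution defining the product reduces to the
   single degree [mweight w m]. *)
apply: eq_bigr => m _; rewrite mulrC /=.
rewrite (@gr_mul_funE _ _ _ [:: mweight w m]) //; last first.
  by move=> c; rewrite inE => /negbTE cm; rewrite gr_in_degE cm.
rewrite big_seq1 gr_in_degE eqxx gr_piece_mulE ?subKl //= ?mvalX ?mvalC //.
  by rewrite mulrC mul_mpolyC.
exact: gr_rep_le.
Qed.

Lemma gr_eval_component_eq0 P g :
  gr_eval P g = 0 <-> forall m, P@_m (g - mweight w m) = 0.
Proof.
(* The case distinction matters: [gr_rep 0] represents the zero class but need not be [0], whereas
   the coefficients outside [msupp P] are exactly [0]. *)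
have coef m : (\sum_(m <- msupp P)
    gr_rep (P@_m (g - mweight w m)) *: 'X_[m])@_m =
    if m \in msupp P then gr_rep (P@_m (g - mweight w m)) else 0.
  by rewrite mcoeff_filter ?msupp_uniq // andbT.
have lt_term c (m : 'X_{1..n}) :
    (nu c +^ fin (mweight w m) < fin g) = (nu c < fin (g - mweight w m)).
  by rewrite -(ext_ltDfin (mweight w m) (nu c)) /= subrK.
rewrite gr_eval_component; set F := \sum_(m <- _) _ in coef *.
have Fle : nuw F <= fin g.
  apply/mval_leP => m; rewrite coef ext_le_subr; case: ifP => _.
    exact: gr_rep_le.
  by rewrite valuation0 ext_leN.
split=> [/eqP|P0].
  rewrite gr_class_eq0 // => /mval_ltP Flt m; have := Flt m.
  rewrite coef lt_term; case: ifP => [_|/negbT/memN_msupp_eq0 -> //].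
  by rewrite -gr_class_eq0 ?gr_rep_le // gr_repK => /eqP.
apply/eqP; rewrite gr_class_eq0 //; apply/mval_ltP => m.
rewrite coef lt_term; case: ifP => _; last by rewrite valuation0 ext_ltN.
by rewrite -gr_class_eq0 ?gr_rep_le // gr_repK P0.
Qed.

Lemma gr_eval_eq0 P : gr_eval P = 0 -> P = 0.
Proof.
move=> P0; apply/mpolyP => m; rewrite mcoeff0; apply/grP => d.
(* The component of [P@_m] in degree [d] is detected in this degree of [gr_eval P]. *)
have /gr_eval_component_eq0/(_ m) : gr_eval P (d + mweight w m) = 0.
  by rewrite P0.
by rewrite addrK.
Qed.

(** Translation by [mweight w m] matches the degrees of [P@_m] other than [g - mweight w m] with the
    degrees of [gr_eval P] other than [g]. *)
Lemma gr_eval_homog g P : mpoly_homog w g P <-> gr_homog g (gr_eval P).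
Proof.
split=> [hP d dg|hP m d dg].
  by apply/gr_eval_component_eq0 => m; apply: hP; rewrite (inj_eq (addIr _)).
have /gr_eval_component_eq0/(_ m) : gr_eval P (d + mweight w m) = 0.
  by apply: hP; apply: contra_neq dg => <-; rewrite addrK.
by rewrite addrK.
Qed.

(** Used twice: with all terms of [f] for surjectivity, and with the terms of maximal valuation for
    the initial form. The bound on [f] puts each term in the filtration step [g]. *)
Lemma gr_eval_sum_terms g f (r : seq 'X_{1..n}) (Q : pred 'X_{1..n}) :
  nuw f <= fin g ->
  gr_eval (\sum_(m <- r | Q m) gr_in_deg nu (g - mweight w m) f@_m *: 'X_[m]) =
    gr_in_deg nuw g (\sum_(m <- r | Q m) f@_m *: 'X_[m]).
Proof.
move=> /mval_leP hf; rewrite raddf_sum gr_in_deg_sum => [|m _]; last first.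
  by rewrite nuw_monomial.
apply: eq_bigr => m _; have := hf m; rewrite ext_le_subr => hm.
by rewrite [LHS]gr_eval_term ?subrK.
Qed.

Lemma gr_eval_surj b : exists P, gr_eval P = b.
Proof.
elim/gr_ind: b => [|b c [P <-] [Q <-]|g f hf].
- by exists 0; rewrite raddf0.
- by exists (P + Q); rewrite raddfD.
by have := gr_eval_sum_terms (msupp f) xpredT hf; rewrite -mpolyE => <-; eexists.
Qed.

Lemma gr_eval_bij : bijective gr_eval.
Proof.
pose inv b := projT1 (cid (gr_eval_surj b)).
have invK : cancel inv gr_eval by move=> b; exact: projT2 (cid (gr_eval_surj b)).
by exists inv => // P; apply: (raddf_inj gr_eval_eq0); apply: invK.
Qed.

Lemma initial_gr_eval f : initial nuw f = gr_eval (initial_poly nu w f).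
Proof.
have [->|/(mval_fin nu w)[g fg]] := eqVneq f 0.
  by rewrite initial0 /initial_poly msupp0 big_nil raddf0.
(* A selected term has valuation exactly [g], so its coefficient has valuation [g - mweight w m] and
   [initial] is its class in that degree. *)
have -> : initial_poly nu w f = \sum_(m <- msupp f | mval_max nu w f m)
    gr_in_deg nu (g - mweight w m) f@_m *: 'X_[m].
  apply: eq_big => [m|m]; rewrite nuw_monomial // => /eqP.
  rewrite [nuw f]fg; case E: (nu f@_m) => [a|] //= /fin_inj <-.
  by rewrite (initialE E) addrK.
have fle : nuw f <= fin g by rewrite [nuw f]fg.
rewrite gr_eval_sum_terms // (@initialE _ _ nuw _ _ fg); apply: gr_in_deg_eq => //.
  by rewrite -fg; exact: mval_top_le.
exact: mval_rest_lt.
Qed.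

End Evaluation.

Theorem proposition4p3 (G : orderedAbGroupType) (K : fieldType)
    (nu : valuation G K) (n : nat) (w : 'I_n -> G) :
  let nuw : valuation G {mpoly K[n]} := monomial_valuation nu w in
  let x (i : 'I_n) : gr nuw := initial nuw 'X_i in
  let ev (P : {mpoly (gr nu)[n]}) : gr nuw := mmap (gr_scalar w) x P in
  [/\ exists phi : {rmorphism {mpoly (gr nu)[n]} -> gr nuw},
        graded_isomorphism (mpoly_homog w) (@gr_homog G _ nuw) phi
        /\ phi =1 ev,
      generated_by (gr_scalar w) x,
      algebraically_independent (gr_scalar w) x
    & forall f : {mpoly K[n]}, initial nuw f = ev (initial_poly nu w f)].
Proof.
move=> nuw x ev; split.
- exists (gr_eval w : {rmorphism _ -> _}); split=> //.
  by split; [exact: gr_eval_bij|exact: gr_eval_homog].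
- by move=> b; have [P <-] := gr_eval_surj b; exists P.
- exact: gr_eval_eq0.
exact: initial_gr_eval.
Qed.
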